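(* Let $P\ge 1$ be an integer, let $u:\mathbb{Z}/P\mathbb{Z}\to\mathbb{Z}$ be a function (a tile), and let $m\in\mathbb{Z}$, $m\ne 0$. Let $Q_u(x)$ and $\tilde d_u(x)$ be the polynomials defined in the context. 1) An $m$-multitiling $v$ of the group $\mathbb{Z}/P\mathbb{Z}$ with the tile $u$ exists if and only if $m\cdot\tilde d_u(1)$ is divisible by $Q_u(1)$. 2) If $m\cdot \tilde d_u(1)$ is divisible by $Q_u(1)$, $P=q^t$ for some prime $q$ and positive integer $t$, and, in addition, $0<m\le Q_u(1)$, then there exists an $m$-tiling $v$ of the group $\mathbb{Z}/P\mathbb{Z}$ with the tile $u$.
   Context: An $m$-multitiling of a finite abelian group $H$ with a tile $u:H\to\mathbb{Z}$ is a function $v:H\to\mathbb{Z}$ such that $\sum_{h\in H}u(g-h)v(h)=m$ for each $g\in H$. An $m$-tiling of $H$ with the tile $u$ is an $m$-multitiling $v$ with $v(h)\in\{0,1\}$ for each $h\in H$. For $H=\mathbb{Z}/P\mathbb{Z}$ put $Q_u(x)=\sum_{a=0}^{P-1}u(a)x^a$ and $$\tilde d_u(x)=\prod_{n:\; n\mid P,\ \Phi_n(x)\mid Q_u(x),\ n\text{ is a prime power}}\Phi_n(x),$$ where $\Phi_n$ is the $n$-th cyclotomic polynomial and a prime power means $p^j$ with $p$ prime and $j\ge1$ (so $1$ is not a prime power); an empty product is $1$. ''$x$ is divisible by $y$'' for integers means $x=yz$ for some integer $z$ (so only $0$ is divisible by $0$). *)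

(* Defs.v *)
From HB Require Import structures.
From mathcomp Require Import all_boot all_order all_algebra all_field.

Set Implicit Arguments.
Unset Strict Implicit.
Unset Printing Implicit Defensive.

Import Order.TTheory GRing.Theory Num.Theory.
Local Open Scope ring_scope.

Definition multitiling (H : finZmodType) (m : int) (u v : H -> int) : Prop :=
  forall g : H, \sum_(h : H) u (g - h) * v h = m.

Definition tiling (H : finZmodType) (m : int) (u v : H -> int) : Prop :=
  multitiling m u v /\ forall h : H, v h = 0 \/ v h = 1.

(* The bounds on p and j make the existential decidable; they are harmless,   *)
(* since p ^ j = n with p prime and 0 < j forces p <= n and j <= n.           *)
Definition prime_power (n : nat) : bool :=
  [exists p : 'I_n.+1, exists j : 'I_n.+1,
     [&& prime p, (0 < j)%N & n == (p ^ j)%N]].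

Lemma prime_powerP (n : nat) :
  reflect (exists p j : nat, [/\ prime p, (0 < j)%N & n = (p ^ j)%N])
          (prime_power n).
Proof.
apply: (iffP existsP) => [[p /existsP[j /and3P[pp j0 /eqP e]]]|[p [j [pp j0 e]]]].
  by exists p, j.
have p1 := prime_gt1 pp.
have ltj : (j < n.+1)%N by rewrite e ltnS ltnW // ltn_expl.
have ltp : (p < n.+1)%N by rewrite e ltnS -{1}(expn1 p) leq_exp2l.
exists (Ordinal ltp); apply/existsP; exists (Ordinal ltj) => /=.
by rewrite pp j0 e eqxx.
Qed.

(* Z/PZ for P = k.+1 >= 1 is 'I_k.+1 with its canonical addition modulo k.+1  *)
(* (not 'Z_P, which is Z/2Z when P = 1).                                      *)
Definition Qpoly (k : nat) (u : 'I_k.+1 -> int) : {poly int} :=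
  \sum_(a < k.+1) (u a)%:P * 'X^a.

(* On {poly int}, %| is defined by pseudo-division; since 'Phi_n is monic it  *)
(* is here divisibility in Z[x] (equivalently in Q[x]).                       *)
Definition dtilde (k : nat) (u : 'I_k.+1 -> int) : {poly int} :=
  \prod_(n <- divisors k.+1 | ('Phi_n %| Qpoly u) && prime_power n) 'Phi_n.

(* Main.v *)
(* Modulo X^P - 1, a multitiling is a polynomial W with
   Q_u W = m (1 + X + ... + X^(P-1)).  Write 1 + X + ... + X^(P-1) = D E, where
   D (resp. E) is the product of the cyclotomic polynomials Phi_n, n | P, n > 1,
   that divide (resp. do not divide) Q_u.  Each factor of E must divide W, so
   W = V E, and comparing values at 1 gives Q_u(1) V(1) = m D(1); conversely,
   this equality is all that is needed for V E to be a solution.  Finally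
   D(1) = +/- dtilde_u(1), since Phi_n(1) = +/- 1 when n is not a prime power.
   When P is a prime power, D and E have nonnegative coefficients, and V can be
   chosen coefficientwise between 0 and D, so that V E lies below D E. *)
Require Import Defs.
From HB Require Import structures.
From mathcomp Require Import all_boot all_order all_algebra all_field.

Set Implicit Arguments.
Unset Strict Implicit.
Unset Printing Implicit Defensive.

Import Order.TTheory GRing.Theory Num.Theory.
Local Open Scope ring_scope.

Local Notation pZtoQ := (map_poly (intr : int -> rat)).
Local Notation pZtoC := (map_poly (intr : int -> algC)).

(* [Num.nneg] is a qualifier, on which the closure lemmas are not inferred. *)
Local Notation nneg := Num.Def.nneg_num_pred.

(** * Values of cyclotomic polynomials at 1 *)

Definition geomp (n : nat) : {poly int} := \sum_(i < n) 'X^i.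

Lemma coef_geomp n i : (geomp n)`_i = (i < n)%N%:R.
Proof.
have -> : geomp n = \poly_(j < n) 1.
  by rewrite poly_def; apply: eq_bigr => j _; rewrite scale1r.
by rewrite coef_poly; case: ltnP.
Qed.

Lemma horner1_geomp n : (geomp n).[1] = n%:R.
Proof.
rewrite horner_sum (eq_bigr (fun=> 1)) => [|i _].
  by rewrite sumr_const card_ord.
by rewrite hornerXn expr1n.
Qed.

Lemma Xn_sub1E n : 'X^n - 1 = ('X - 1) * geomp n :> {poly int}.
Proof. exact: subrX1. Qed.

Lemma prod_Cyclotomic_neq1 n : (0 < n)%N ->
  \prod_(d <- divisors n | d != 1%N) 'Phi_d = geomp n.
Proof.
move=> n0; have := prod_Cyclotomic (ltn0Sn 0); rewrite big_seq1 expr1 => Phi1.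
have nzX1 : 'X - 1 != 0 :> {poly int} by rewrite polyXsubC_eq0.
apply: (mulfI nzX1); rewrite -Xn_sub1E -prod_Cyclotomic // [RHS](bigD1_seq 1%N).
- by rewrite Phi1.
- by rewrite -dvdn_divisors.
- exact: divisors_uniq.
Qed.

Lemma prod_Cyclotomic_horner1 n : (0 < n)%N ->
  \prod_(d <- divisors n | d != 1%N) ('Phi_d).[1] = n%:R.
Proof.
by move=> n0; rewrite -horner_prod prod_Cyclotomic_neq1 // horner1_geomp.
Qed.

Lemma divisors_filter_dvdn (a n : nat) : (0 < n)%N -> (a %| n)%N ->
  perm_eq [seq d <- divisors n | (d %| a)%N] (divisors a).
Proof.
move=> n0 an; have a0 := dvdn_gt0 n0 an.
apply: uniq_perm; rewrite ?filter_uniq ?divisors_uniq // => d.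
rewrite mem_filter -!dvdn_divisors //.
by case: (boolP (d %| a)%N) => //= /dvdn_trans ->.
Qed.

(* The divisors of a and those of b other than 1 already account for the
   value a * b at 1 of the product over all divisors of a * b other than 1. *)
Lemma Cyclotomic_horner1_coprime a b : (1 < a)%N -> (1 < b)%N -> coprime a b ->
  ('Phi_(a * b)).[1] \is a GRing.unit.
Proof.
move=> a1 b1 cab; have [a0 b0] := (ltnW a1, ltnW b1).
have n0 : (0 < a * b)%N by rewrite muln_gt0 a0.
have := prod_Cyclotomic_horner1 n0.
have split c (P : pred nat) : (c %| a * b)%N ->
    (forall d, (d %| c)%N -> d != 1%N -> P d) ->
    \prod_(d <- divisors (a * b) | (d != 1%N) && P d && (d %| c)%N) ('Phi_d).[1]
      = c%:R.
  move=> cn Pc; have c0 := dvdn_gt0 n0 cn.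
  rewrite -(prod_Cyclotomic_horner1 c0).
  rewrite -(perm_big _ (divisors_filter_dvdn n0 cn)).
  rewrite big_filter_cond; apply: eq_bigl => d.
  case: (boolP (d %| c)%N) => [dc|]; rewrite ?andbF //= andbT.
  by case: eqP => //= /eqP d1; rewrite Pc.
have ndvd c e : (0 < c)%N -> (1 < e)%N -> ~~ (c * e %| c)%N.
  move=> c0 e1; apply: contraL e1 => /dvdn_leq -/(_ c0).
  by rewrite -{2}[c]muln1 leq_pmul2l // -leqNgt.
rewrite (bigID (fun d => (d %| a)%N)) /=.
have := split a xpredT (dvdn_mulr _ (dvdnn _)) (fun _ _ _ => isT).
under eq_bigl do rewrite andbT; move=> ->.
rewrite (bigID (fun d => (d %| b)%N)) /= split ?dvdn_mull //; last first.
  move=> d db; apply: contra => da; rewrite -dvdn1.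
  by rewrite -(eqP cab) dvdn_gcd da.
(* The index [a * b] divides neither [a] nor [b], so its factor is among the remaining ones, whose
   product is 1. *)
rewrite -big_filter (bigD1_seq (a * b)%N) ?filter_uniq ?divisors_uniq //=;
  last first.
  rewrite mem_filter -dvdn_divisors // dvdnn andbT ndvd //.
  rewrite [in X in _ && X]mulnC ndvd // !andbT.
  by rewrite neq_ltn (leq_trans a1) ?orbT ?leq_pmulr.
rewrite natrM !mulrA -mulrA -[RHS]mulr1 => E.
apply/unitrPr; eexists; apply: mulfI E.
by rewrite -natrM pnatr_eq0 -lt0n.
Qed.

(** With p the least prime divisor of n, the p-part of n and its cofactor are coprime, and both
    exceed 1 because n is not a power of p. *)
Lemma Cyclotomic_horner1_unit n : (0 < n)%N -> n != 1%N -> ~~ prime_power n ->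
  ('Phi_n).[1] \is a GRing.unit.
Proof.
move=> n0 n1 npp; pose p := pdiv n.
have n_gt1 : (1 < n)%N by rewrite ltn_neqAle eq_sym n1.
have pp : prime p := pdiv_prime n_gt1.
rewrite -(partnC p n0) !p_part.
have l0 : (0 < logn p n)%N by rewrite logn_gt0 mem_primes pp n0 pdiv_dvd.
apply: Cyclotomic_horner1_coprime; first 2 last.
- by rewrite -p_part coprime_partC.
- by rewrite -{1}(expn0 p) ltn_exp2l // prime_gt1.
- rewrite ltn_neqAle part_gt0 andbT eq_sym; apply: contra npp => /eqP nC.
  apply/prime_powerP; exists p, (logn p n); split=> //.
  by rewrite -p_part -{1}(partnC p n0) nC muln1.
Qed.

(** The divisors of q^(j+1) other than itself are those of q^j, so this polynomial is the quotient
    of X^(q^(j+1)) - 1 by X^(q^j) - 1. *)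
Lemma Cyclotomic_prime_power q j : prime q ->
  'Phi_(q ^ j.+1) = \sum_(i < q) 'X^(q ^ j) ^+ i.
Proof.
move=> pq; have q1 := prime_gt1 pq; have q0 := ltnW q1.
have n0 i : (0 < q ^ i)%N by rewrite expn_gt0 q0.
have nz : 'X^(q ^ j) - 1 != 0 :> {poly int}.
  by rewrite -size_poly_gt0 size_XnsubC.
apply: (mulfI nz); rewrite -subrX1 -exprM -expnSr -!prod_Cyclotomic //.
rewrite [RHS](bigD1_seq (q ^ j.+1)%N) ?divisors_uniq -?dvdn_divisors //=.
rewrite mulrC; congr (_ * _); rewrite -[RHS]big_filter; apply: perm_big.
apply: uniq_perm; rewrite ?filter_uniq ?divisors_uniq // => d.
rewrite mem_filter -!dvdn_divisors //.
apply/idP/andP => [|[dn /(dvdn_pfactor _ _ pq)[i le_i Dd]]].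
  case/(dvdn_pfactor _ _ pq) => i le_i ->; rewrite dvdn_exp2l ?leqW //.
  by rewrite eqn_exp2l // neq_ltn ltnS le_i.
apply/(dvdn_pfactor _ _ pq); exists i => //.
by move: dn; rewrite Dd eqn_exp2l // => ?; rewrite -ltnS ltn_neqAle le_i andbT.
Qed.

Lemma Cyclotomic_prime_power_nneg n : prime_power n ->
  'Phi_n \is a polyOver nneg.
Proof.
case/prime_powerP => q [[|j] [pq // _ ->]]; rewrite Cyclotomic_prime_power //.
by apply: rpred_sum => i _; rewrite -exprM polyOverXn.
Qed.

(** * Divisibility by cyclotomic polynomials *)

Lemma root_Cyclotomic n (z : algC) : (0 < n)%N ->
  root (pZtoC 'Phi_n) z = n.-primitive_root z.
Proof.
move=> n0; have [w pw] := C_prim_root_exists n0.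
by rewrite (Cintr_Cyclotomic pw) root_cyclotomic.
Qed.

(** Over the rationals, ['Phi_n] is the minimal polynomial of [z]. *)
Lemma Cyclotomic_dvdp n (z : algC) f : n.-primitive_root z ->
  ('Phi_n %| f) = root (pZtoC f) z.
Proof.
move=> pz; have [p [Dp _ rootp]] := minCpolyP z.
have QtoC (g : {poly int}) : pZtoC g = map_poly ratr (pZtoQ g).
  by rewrite -map_poly_comp; apply: eq_map_poly => x /=; rewrite ratr_int.
have Ep : p = pZtoQ 'Phi_n.
  apply: (map_poly_inj (ratr : {rmorphism rat -> algC})).
  by rewrite -QtoC (Cintr_Cyclotomic pz) -Dp (minCpoly_cyclotomic pz).
by rewrite QtoC rootp Ep dvdp_rat_int.
Qed.

Lemma Cyclotomic_Euclid n f g : (0 < n)%N ->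
  ('Phi_n %| f * g) = ('Phi_n %| f) || ('Phi_n %| g).
Proof.
move=> n0; have [z pz] := C_prim_root_exists n0.
by rewrite !(Cyclotomic_dvdp _ pz) rmorphM rootM.
Qed.

(** A nonconstant gcd would have a root in [algC], of exact order both m and n. *)
Lemma coprimep_Cyclotomic m n : (0 < m)%N -> (0 < n)%N -> m != n ->
  coprimep 'Phi_m 'Phi_n.
Proof.
move=> m0 n0; apply: contraR; rewrite coprimep_def => szg.
set g := gcdp _ _ in szg.
have root_g f : g %| f -> forall z, root (pZtoC g) z -> root (pZtoC f) z.
  (* Pseudo-division gives a factorisation only up to a nonzero scalar [c], which leaves the roots
     unchanged. *)
  case/Pdiv.Idomain.dvdpP => -[c h] /= c0 E z rz.
  have : root (pZtoC (c *: f)) z by rewrite E rmorphM rootM rz orbT.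
  by rewrite map_polyZ rootZ // intr_eq0.
have /closed_rootP[z rz] : size (pZtoC g) != 1%N.
  by rewrite size_map_inj_poly //; apply: intr_inj.
have := root_g _ (dvdp_gcdl _ _) z rz; have := root_g _ (dvdp_gcdr _ _) z rz.
rewrite !root_Cyclotomic // eqn_dvd => pn pm.
by rewrite (prim_order_dvd pm) (prim_order_dvd pn) !prim_expr_order ?eqxx.
Qed.

Lemma prod_Cyclotomic_dvdp (s : seq nat) (P : pred nat) f :
  uniq s -> (forall n, n \in s -> (0 < n)%N) ->
  (forall n, n \in s -> P n -> 'Phi_n %| f) ->
  \prod_(n <- s | P n) 'Phi_n %| f.
Proof.
elim: s => [|n s IH] /=; first by rewrite big_nil dvd1p.
case/andP => ns us s0 sf; rewrite big_cons.
have {}IH : \prod_(n <- s | P n) 'Phi_n %| f.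
  by apply: IH => // d ds *; [apply: s0|apply: sf]; rewrite ?inE ?ds ?orbT.
case: ifP => // Pn; rewrite Pdiv.Idomain.Gauss_dvdp ?IH ?sf ?mem_head //.
rewrite big_seq_cond; elim/big_ind: _ => [|p q|d].
- by rewrite coprimep1.
- by rewrite coprimepMr => -> ->.
- move=> /andP[ds _]; apply: coprimep_Cyclotomic.
  + by rewrite s0 ?mem_head.
  + by rewrite s0 // inE ds orbT.
  + by apply: contraNneq ns => ->.
Qed.

Lemma monic_prod_Cyclotomic (s : seq nat) (P : pred nat) :
  \prod_(n <- s | P n) 'Phi_n \is monic.
Proof. by apply: monic_prod => n _; apply: Cyclotomic_monic. Qed.

(** * Multitilings as congruences modulo X^P - 1 *)

Lemma dvdp_Xn_sub1 (n j : nat) : ('X^n - 1 : {poly int}) %| 'X^j - 'X^(j %% n).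
Proof.
rewrite {1}(divn_eq j n) addnC exprD mulnC exprM -{2}['X^(j %% n)]mulr1 -mulrBr.
by rewrite (subrX1 'X^n) dvdp_mull // dvdp_mulr.
Qed.

Section Qpoly.
Variable k : nat.
Implicit Types u v : 'I_k.+1 -> int.
Local Notation P := k.+1.

Lemma coef_Qpoly u i : (Qpoly u)`_i = if (i < P)%N then u (inord i) else 0.
Proof.
have -> : Qpoly u = \poly_(j < P) u (inord j).
  by rewrite poly_def; apply: eq_bigr => j _; rewrite inord_val mul_polyC.
by rewrite coef_poly.
Qed.

Lemma Qpoly_coef (W : {poly int}) : (size W <= P)%N ->
  Qpoly (fun i : 'I_P => W`_i) = W.
Proof.
move=> sW; apply/polyP => i; rewrite coef_Qpoly; case: ltnP => iP.
  by rewrite inordK.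
by rewrite nth_default // (leq_trans sW).
Qed.

(** Reducing exponents modulo P turns the product of polynomials into cyclic convolution. *)
Lemma dvdp_Xn_sub1_conv u v : ('X^P - 1 : {poly int}) %|
  Qpoly u * Qpoly v - Qpoly (fun g => \sum_h u (g - h) * v h).
Proof.
have -> : Qpoly u * Qpoly v
    = \sum_(h < P) \sum_(a < P) (u a * v h)%:P * 'X^(a + h).
  rewrite mulrC /Qpoly mulr_suml; apply: eq_bigr => h _.
  rewrite mulr_sumr; apply: eq_bigr => a _.
  by rewrite mulrACA -exprD -polyCM mulrC addnC [v h * _]mulrC [LHS]mulrC.
have -> : Qpoly (fun g => \sum_h u (g - h) * v h)
    = \sum_(h < P) \sum_(a < P) (u a * v h)%:P * 'X^((a + h) %% P).
  rewrite /Qpoly.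
  under eq_bigr do rewrite rmorph_sum mulr_suml.
  rewrite exchange_big; apply: eq_bigr => h _.
  (* Substitute g = a + h, where addition in ['I_P] is modulo P. *)
  rewrite (reindex_inj (addIr h)); apply: eq_bigr => a _.
  by rewrite addrK.
rewrite -sumrB; elim/big_rec: _ => [|h p _ dp]; first exact: dvdp0.
rewrite dvdp_add // -sumrB; elim/big_rec: _ => [|a q _ dq]; first exact: dvdp0.
by rewrite dvdp_add // -mulrBr dvdp_mull // dvdp_Xn_sub1.
Qed.

(** Both the convolution polynomial and [m *: geomp P] have degree below P, so their congruence
    modulo X^P - 1 is an equality of coefficients. *)
Lemma multitilingE (m : int) u v : multitiling m u v <->
  ('X^P - 1 : {poly int}) %| Qpoly u * Qpoly v - m *: geomp P.
Proof.
have Qm : Qpoly (fun _ : 'I_P => m) = m *: geomp P.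
  apply/polyP => i; rewrite coef_Qpoly coefZ coef_geomp.
  by case: ltnP; rewrite ?mulr1 ?mulr0.
set c := fun g => \sum_h u (g - h) * v h.
have -> : (('X^P - 1 : {poly int}) %| Qpoly u * Qpoly v - m *: geomp P)
    = (('X^P - 1 : {poly int}) %| Qpoly c - m *: geomp P).
  by rewrite -(subrKA (Qpoly c) (Qpoly u * Qpoly v)) dvdp_addr //
    dvdp_Xn_sub1_conv.
rewrite -Qm; split=> [H|dQ].
  have -> : Qpoly c = Qpoly (fun _ : 'I_P => m).
    by rewrite /Qpoly; apply: eq_bigr => g _; rewrite /c H.
  by rewrite subrr dvdp0.
have szQ (w : 'I_P -> int) : (size (Qpoly w) <= P)%N.
  by apply/leq_sizeP => j Pj; rewrite coef_Qpoly ltnNge Pj.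
have : Qpoly c - Qpoly (fun _ : 'I_P => m) = 0.
  apply/eqP; apply: contraTT dQ => nz; apply/negP => /(dvdp_leq nz).
  rewrite size_XnsubC // => /leq_trans/(_ (size_polyD _ _)).
  by rewrite size_polyN leq_max !ltnNge !szQ.
move=> E g; have /eqP := congr1 (fun p : {poly int} => p`_g) E.
by rewrite coefB !coef_Qpoly ltn_ord inord_val coef0 subr_eq0 => /eqP.
Qed.

(** Any solution [W] can be replaced by its remainder modulo the monic X^P - 1, whose coefficients
    form a function on Z/PZ. *)
Lemma multitiling_existsP (m : int) u :
  (exists v, multitiling m u v) <->
  exists W : {poly int}, 'X^P - 1 %| Qpoly u * W - m *: geomp P.
Proof.
split=> [[v /multitilingE]|[W dW]]; first by exists (Qpoly v).
have monP : ('X^P - 1 : {poly int}) \is monic by rewrite monicXnsubC.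
exists (fun i : 'I_P => (W %% ('X^P - 1))`_i); apply/multitilingE.
rewrite Qpoly_coef; last first.
  by rewrite -ltnS -(size_XnsubC (1 : int) (ltn0Sn k)) ltn_modp monic_neq0.
move: dW; rewrite {1}(Pdiv.IdomainMonic.divp_eq monP W) mulrDr -addrA.
by rewrite dvdp_addr // mulrA dvdp_mull.
Qed.

End Qpoly.

(** * Polynomials with nonnegative coefficients *)

Lemma horner1_nneg (p : {poly int}) : p \is a polyOver nneg -> 0 <= p.[1].
Proof.
move=> /polyOverP pP; rewrite horner_coef; apply: sumr_ge0 => i _.
by rewrite expr1n mulr1; apply: pP.
Qed.

(** Induction on [w]: while W(1) < D(1), some coefficient of D - W is nonzero, hence at least 1, and
    the same coefficient of W can be raised by 1. *)
Lemma nneg_poly_between (D : {poly int}) (w : nat) :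
  D \is a polyOver nneg -> w%:Z <= D.[1] ->
  exists W : {poly int}, [/\ W \is a polyOver nneg,
    D - W \is a polyOver nneg & W.[1] = w%:Z].
Proof.
move=> Dge0; elim: w => [|w IH] le_w.
  by exists 0; rewrite subr0 horner0 rpred0.
have [|W [Wge0 DWge0 W1]] := IH; first by rewrite (le_trans _ le_w) // lez_nat.
have /existsP[i DWi] : [exists i : 'I_(size (D - W)), (D - W)`_i != 0].
  apply: contraTT le_w; rewrite negb_exists => /forallP z.
  suff : (D - W).[1] = 0.
    rewrite !hornerE W1 => /eqP; rewrite subr_eq0 => /eqP ->.
    by rewrite -ltNge ltz_nat.
  by rewrite horner_coef big1 // => j _; rewrite (eqP (negbNE (z j))) mul0r.
exists (W + 'X^i); rewrite rpredD ?polyOverXn // hornerD hornerXn W1 expr1n.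
split=> //; last by rewrite -addn1 PoszD.
apply/polyOverP => j; rewrite opprD addrA coefB coefXn.
have := polyOverP DWge0 j; rewrite -!topredE /=.
case: eqP => [->|]; last by rewrite subr0.
by rewrite subr_ge0 le0r (negPf DWi) /= gtz0_ge1.
Qed.

(** * The factorisation 1 + X + ... + X^(P-1) = D E *)

Definition cyclo_part (k : nat) (u : 'I_k.+1 -> int) : {poly int} :=
  \prod_(n <- divisors k.+1 | (n != 1%N) && ('Phi_n %| Qpoly u)) 'Phi_n.

Definition cyclo_copart (k : nat) (u : 'I_k.+1 -> int) : {poly int} :=
  \prod_(n <- divisors k.+1 | (n != 1%N) && ~~ ('Phi_n %| Qpoly u)) 'Phi_n.

Section CycloPart.
Variables (k : nat) (u : 'I_k.+1 -> int).
Local Notation P := k.+1.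
Local Notation D := (cyclo_part u).
Local Notation E := (cyclo_copart u).

Lemma geomp_split : geomp P = D * E.
Proof.
rewrite -prod_Cyclotomic_neq1 //.
exact: (bigID (fun n => 'Phi_n %| Qpoly u)).
Qed.

Lemma cyclo_horner1_neq0 : D.[1] != 0 /\ E.[1] != 0.
Proof.
by apply/andP; rewrite -negb_or -mulf_eq0 -hornerM -geomp_split
  horner1_geomp pnatr_eq0.
Qed.

Lemma divisors_gt0 n : n \in divisors P -> (0 < n)%N.
Proof. by rewrite -dvdn_divisors // => /dvdn_gt0 ->. Qed.

Lemma cyclo_part_dvdp : D %| Qpoly u.
Proof.
apply: prod_Cyclotomic_dvdp.
- exact: divisors_uniq.
- exact: divisors_gt0.
- by move=> n _ /andP[].
Qed.

(* Dropping the factors that are not at prime powers only changes the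
   value at 1 by a sign. *)
Lemma dvdz_dtilde (a m : int) :
  (a %| m * (dtilde u).[1])%Z = (a %| m * D.[1])%Z.
Proof.
have -> : D = dtilde u *
    \prod_(n <- divisors P |
      [&& n != 1%N, 'Phi_n %| Qpoly u & ~~ prime_power n]) 'Phi_n.
  rewrite /cyclo_part (bigID prime_power) /=; congr (_ * _); last first.
    by apply: eq_bigl => n; rewrite andbA.
  (* The condition n != 1 is absent from [dtilde], but 1 is not a prime power. *)
  apply: eq_bigl => n; rewrite -andbA; case: eqP => // ->; symmetry.
  apply/negbTE; rewrite negb_and orbC; apply/orP; left.
  apply/negP => /prime_powerP[p [j [pp j0 /eqP]]].
  by rewrite eq_sym -(expn0 p) eqn_exp2l ?prime_gt1 // (gtn_eqF j0).
set F := \prod_(n <- _ | [&& _, _ & _]) _.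
have uF : F.[1] \is a GRing.unit.
  rewrite horner_prod big_seq_cond rpred_prod // => n /and4P[nP n1 _ npp].
  by rewrite Cyclotomic_horner1_unit // divisors_gt0.
rewrite hornerM mulrA; case/orP: uF => /eqP ->.
  by rewrite mulr1.
by rewrite mulrN1 !dvdzE abszN.
Qed.

(** After cancelling E, it remains that (X - 1) D divides Q_u W - m D. D divides both terms, and the
    quotient vanishes at 1 because D(1) is nonzero. *)
Lemma dvdp_of_horner1 (m : int) (W : {poly int}) :
  (Qpoly u).[1] * W.[1] = m * D.[1] ->
  'X^P - 1 %| Qpoly u * (W * E) - m *: geomp P.
Proof.
move=> eq1; rewrite Xn_sub1E geomp_split !mulrA scalerAl -mulrBl.
apply: dvdp_mul => //; set F := (X in _ %| X).
have dF : D %| F.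
  by rewrite dvdp_sub ?dvdp_mulr ?cyclo_part_dvdp // -mul_polyC
    dvdp_mull.
have /(Pdiv.IdomainMonic.dvdpP (monic_prod_Cyclotomic _ _))[G FE] := dF.
rewrite FE dvdp_mul // -polyC1 dvdp_XsubCl rootE.
have /eqP : F.[1] = 0 by rewrite hornerD hornerN hornerM hornerZ eq1 subrr.
by rewrite FE hornerM mulf_eq0 (negPf cyclo_horner1_neq0.1) orbF.
Qed.

(** Modulo [geomp P] the term in m vanishes, so each factor of E divides Q_u W, hence W, being prime
    and not dividing Q_u. Evaluate at 1 and cancel E(1). *)
Lemma dvdz_of_multitiling (m : int) (W : {poly int}) :
  'X^P - 1 %| Qpoly u * W - m *: geomp P ->
  ((Qpoly u).[1] %| m * D.[1])%Z.
Proof.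
rewrite Xn_sub1E => dW; have dS := dvdp_trans (dvdp_mull _ (dvdpp _)) dW.
rewrite dvdp_addl in dS; last by rewrite -scaleNr -mul_polyC dvdp_mull.
have /(Pdiv.IdomainMonic.dvdpP (monic_prod_Cyclotomic _ _))[W' WE] : E %| W.
  apply: prod_Cyclotomic_dvdp => [||n nP /andP[n1 ndn]].
  - exact: divisors_uniq.
  - exact: divisors_gt0.
  - have : 'Phi_n %| Qpoly u * W.
      apply: dvdp_trans dS; rewrite -prod_Cyclotomic_neq1 //.
      rewrite -big_filter (bigD1_seq n) ?filter_uniq ?divisors_uniq //=.
        exact: dvdp_mulr.
      by rewrite mem_filter n1.
    by rewrite Cyclotomic_Euclid ?divisors_gt0 // (negPf ndn).
have : root (Qpoly u * W - m *: geomp P) 1.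
  rewrite -dvdp_XsubCl polyC1; apply: dvdp_trans dW; exact: dvdp_mulr.
rewrite rootE hornerD hornerN hornerZ geomp_split WE !hornerM subr_eq0 !mulrA.
by rewrite (inj_eq (mulIf cyclo_horner1_neq0.2)) => /eqP <-; rewrite dvdz_mulr.
Qed.

(* Any W with nonnegative coefficients below those of D gives a tiling W * E:
   the coefficients of W * E are at most those of D * E, which are all 1. *)
Lemma tiling_of_horner1 (m w : int) :
  D \is a polyOver nneg -> E \is a polyOver nneg ->
  (Qpoly u).[1] * w = m * D.[1] -> 0 <= w -> w <= D.[1] ->
  exists v : 'I_P -> int, tiling m u v.
Proof.
move=> Dge0 Ege0 eq1 w0 wD.
have [W [Wge0 DWge0 W1]] : exists W : {poly int}, [/\ W \is a polyOver nneg,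
    D - W \is a polyOver nneg & W.[1] = w].
  by rewrite -(gez0_abs w0) in wD *; apply: nneg_poly_between.
have V0 (i : nat) : 0 <= (W * E)`_i by apply: (polyOverP (rpredM Wge0 Ege0)).
have VS (i : nat) : (W * E)`_i <= (i < P)%N%:R.
  rewrite -coef_geomp -subr_ge0 -coefB geomp_split -mulrBl.
  by apply: (polyOverP (rpredM DWge0 Ege0)).
have sV : (size (W * E)%R <= P)%N.
  apply/leq_sizeP => i Pi; apply/le_anti.
  by rewrite V0 (le_trans (VS i)) // ltnNge Pi.
exists (fun i : 'I_P => (W * E)`_i); split.
  by apply/multitilingE; rewrite Qpoly_coef // dvdp_of_horner1 // W1.
move=> i; have := V0 i; have := VS i; rewrite ltn_ord.
by case: ((W * E)`_i) => [[|[|]]|] // *; [left|right].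
Qed.

End CycloPart.

Theorem lemma1 (k : nat) (u : 'I_k.+1 -> int) (m : int) (hm : m != 0) :
  ((exists v : 'I_k.+1 -> int, multitiling m u v) <->
     ((Qpoly u).[1] %| m * (dtilde u).[1])%Z)
  /\
  (((Qpoly u).[1] %| m * (dtilde u).[1])%Z ->
   (exists q t : nat, [/\ prime q, (0 < t)%N & k.+1 = (q ^ t)%N]) ->
   0 < m -> m <= (Qpoly u).[1] ->
   exists v : 'I_k.+1 -> int, tiling m u v).
Proof.
rewrite !dvdz_dtilde; split.
  apply: iff_trans (multitiling_existsP m u) _; split=> [[W]|/dvdzP[w eq1]].
    exact: dvdz_of_multitiling.
  (* Only the value at 1 of the cofactor of E matters, so a constant suffices. *)
  exists (w%:P * cyclo_copart u); apply: dvdp_of_horner1.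
  by rewrite hornerC mulrC.
move=> /dvdzP[w eq1] [q [t [pq _ Pqt]]] m0 mQ.
(* All divisors of q^t other than 1 are prime powers. *)
have nnegPhi n : n \in divisors k.+1 -> n != 1%N -> 'Phi_n \is a polyOver nneg.
  move=> nP n1; apply: Cyclotomic_prime_power_nneg.
  move: nP; rewrite -dvdn_divisors // Pqt => /(dvdn_pfactor _ _ pq)[j _ nE].
  apply/prime_powerP; exists q, j; split=> //.
  by case: j nE n1 => // ->.
have Dge0 : cyclo_part u \is a polyOver nneg.
  rewrite /cyclo_part big_seq_cond rpred_prod // => n /and3P[nP n1 _].
  exact: nnegPhi.
have Ege0 : cyclo_copart u \is a polyOver nneg.
  rewrite /cyclo_copart big_seq_cond rpred_prod // => n /and3P[nP n1 _].
  exact: nnegPhi.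
have D0 : 0 < (cyclo_part u).[1].
  by rewrite lt0r (cyclo_horner1_neq0 u).1 horner1_nneg.
have Q0 := lt_le_trans m0 mQ.
(* Since w Q_u(1) = m D(1) with Q_u(1), m and D(1) positive, w is nonnegative, and m <= Q_u(1) gives
   w <= D(1). *)
apply: (tiling_of_horner1 Dge0 Ege0 (w := w)).
- by rewrite eq1 mulrC.
- by rewrite -(pmulr_lge0 _ Q0) -eq1 mulr_ge0 ?ltW.
- by rewrite -(ler_pM2r Q0) -eq1 mulrC ler_pM2l.
Qed.
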